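(* Suppose that $H_{ii} \ge 1/2$ for at most one index $i \in \{1,2,\ldots,n\}$. Then for arbitrary indices $i,j \in \{1,2,\ldots,n\}$, \begin{align*} \mathbb{E}\bigl( (\hat{R}_i - R_i)(\hat{R}_j - R_j) \bigr) = \frac{1}{2\pi} \sum_{k,\ell=1}^n \biggl( & \arcsin\Bigl( \frac{\Delta_{k\ell,ij}}{2} \Bigr) + \arcsin\Bigl( \frac{\Delta_{k\ell,ij} - H_{k\ell,ij}}{\sqrt{(2 - H_{kk,ii})(2 - H_{\ell\ell,jj})}} \Bigr) \\ & - \arcsin\Bigl( \frac{\Delta_{k\ell,ij} - H_{k\ell,ij}}{\sqrt{2(2 - H_{kk,ii})}} \Bigr) - \arcsin\Bigl( \frac{\Delta_{k\ell,ij} - H_{k\ell,ij}}{\sqrt{2(2 - H_{\ell\ell,jj})}} \Bigr) \biggr), \end{align*} where $\Delta_{k\ell,ij} := \delta_{k\ell} + \delta_{ij} - \delta_{kj} - \delta_{i\ell}$ and $H_{k\ell,ij} := H_{k\ell} + H_{ij} - H_{kj} - H_{i\ell}$. In particular, for every $i \in \{1,2,\ldots,n\}$, \begin{align*} \mathbb{E}\bigl( (\hat{R}_i - R_i)^2 \bigr) = {} & \frac{1}{2\pi} \sum_{k=1}^n \Bigl( \pi - 2\arccos\bigl( \sqrt{H_{kk,ii}/2} \bigr) \Bigr) \\ & + \frac{1}{\pi} \sum_{1 \le k < \ell \le n} \biggl( \frac{\pi}{6} + \arcsin\Bigl( \frac{1 - H_{k\ell,ii}}{\sqrt{(2 - H_{kk,ii})(2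 - H_{\ell\ell,ii})}} \Bigr) \\ & \qquad - \arcsin\Bigl( \frac{1 - H_{k\ell,ii}}{\sqrt{2(2 - H_{kk,ii})}} \Bigr) - \arcsin\Bigl( \frac{1 - H_{k\ell,ii}}{\sqrt{2(2 - H_{\ell\ell,ii})}} \Bigr) \biggr). \end{align*}
   Context: Let $1 \le p < n$ be integers and let $\boldsymbol{D} \in \mathbb{R}^{n\times p}$ be a fixed (non-random) design matrix of full rank $p$. The hat matrix is $\boldsymbol{H} = (H_{ij})_{i,j=1}^n := \boldsymbol{D}(\boldsymbol{D}^\top\boldsymbol{D})^{-1}\boldsymbol{D}^\top$, i.e. the matrix of the orthogonal projection of $\mathbb{R}^n$ onto the column space of $\boldsymbol{D}$; its diagonal entries $H_{ii}$ are called leverages. Let $\varepsilon_1,\ldots,\varepsilon_n$ be independent random variables, each with distribution $\mathcal{N}(0,\sigma^2)$ for some $\sigma > 0$, let $\boldsymbol{\varepsilon} = (\varepsilon_i)_{i=1}^n$, and let $\hat{\boldsymbol{\varepsilon}} = (\hat{\varepsilon}_i)_{i=1}^n := (\boldsymbol{I} - \boldsymbol{H})\boldsymbol{\varepsilon}$, with $\boldsymbol{I}$ the $n\times n$ identity matrix. (These are the residuals of the least squares fit in the linear model $\boldsymbol{Y} = \boldsymbol{\mu} + \boldsymbol{\varepsilon}$ with $\boldsymbol{\mu}$ in the column space of $\boldsymbol{D}$.) The ranks are $$R_i := \sum_{j=1}^n 1_{[\varepsilon_j \le \varepsilon_i]}, \qquad \hat{R}_i := \sum_{j=1}^n 1_{[\hat{\varepsilon}_j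 \le \hat{\varepsilon}_i]}, \qquad 1 \le i \le n.$$ Here $\delta_{st} = 1_{[s=t]}$ is Kronecker's symbol. *)

(* Defs.v *)
From HB Require Import structures.
From mathcomp Require Import all_boot all_order all_algebra.
From mathcomp Require Import all_classical all_reals all_analysis.

Set Implicit Arguments.
Unset Strict Implicit.
Unset Printing Implicit Defensive.

Import Order.TTheory GRing.Theory Num.Theory.
Import numFieldNormedType.Exports.

Local Open Scope classical_set_scope.
Local Open Scope ring_scope.

(* [invmx] is the genuine inverse only when [D^T *m D] is invertible, which
   over a real field is the case exactly when [D] has rank [p]. *)
Definition hat_matrix (R : realType) (n p : nat) (D : 'M[R]_(n, p)) : 'M[R]_n :=
  D *m invmx (D^T *m D) *m D^T.

Definition residuals (R : realType) (n p : nat) (D : 'M[R]_(n, p))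
    (e : 'I_n -> R) (i : 'I_n) : R :=
  ((1%:M - hat_matrix D) *m \col_k e k) i 0.

Definition data_rank (R : realType) (n : nat) (x : 'I_n -> R) (i : 'I_n) : R :=
  \sum_(j < n) (x j <= x i)%R%:R.

Definition Delta4 (R : realType) (n : nat) (k l i j : 'I_n) : R :=
  (k == l)%:R + (i == j)%:R - (k == j)%:R - (i == l)%:R.

Definition H4 (R : realType) (n p : nat) (D : 'M[R]_(n, p))
    (k l i j : 'I_n) : R :=
  let H := hat_matrix D in H k l + H i j - H k j - H i l.

Definition mutually_independent d (T : measurableType d) (R : realType)
    (P : probability T R) (I : finType) (X : I -> {RV P >-> R}) : Prop :=
  forall (J : {set I}) (B : I -> set R), (forall i, measurable (B i)) ->
    P (\bigcap_(i in [set` J]) (X i @^-1` B i)) =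
    (\prod_(i in J) P (X i @^-1` B i))%E.

(* The second parameter of [normal_prob] is the standard deviation.  Equality
   of laws is only required on measurable sets: off them, [normal_prob] is an
   integral over a non-measurable domain. *)
Definition normally_distributed d (T : measurableType d) (R : realType)
    (P : probability T R) (X : {RV P >-> R}) (m s : R) : Prop :=
  forall A : set R, measurable A -> distribution P X A = normal_prob m s A.

(* Main.v *)
(* The rank difference of observation i is a sum over k of differences of
   indicators of half-spaces {<a, eps> <= 0}, where a is the difference of rows
   k and i either of I or of M = I - H.  The mean of a product of two such
   indicators is an orthant probability of a bivariate Gaussian vector, which
   Sheppard's formula evaluates as 1/4 + asin(rho) / (2 pi); the constants 1/4
   cancel, and the correlations rho follow from M being a symmetric idempotent.
   The leverage hypothesis ensures that no nontrivial row difference of M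
   vanishes.

   Sheppard's formula is obtained without densities in R^n.  The plane Gaussian
   measure is invariant under rotations, because a rotation is a product of
   three shears, which preserve Lebesgue measure.  Adding the independent
   variables eps_k one at a time, two Givens rotations bring the law of
   (<a, eps>, <b, eps>) to that of (u x, v x + t y) with (x, y) plane Gaussian;
   the resulting planar sector is measured by the substitution y = x s. *)
Require Import Defs.
From HB Require Import structures.
From mathcomp Require Import all_boot all_order all_algebra.
From mathcomp Require Import all_classical all_reals all_analysis.
From mathcomp Require Import measurable_realfun ring lra.

Set Implicit Arguments.
Unset Strict Implicit.
Unset Printing Implicit Defensive.

Import Order.TTheory GRing.Theory Num.Theory.
Import numFieldNormedType.Exports.

Local Open Scope classical_set_scope.
Local Open Scope ring_scope.

(** * Affine substitution in Lebesgue integrals on the line *)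

Section affine_substitution.
Context {R : realType}.
Local Notation mu := (@lebesgue_measure R).

Definition affine (k c : R) (x : measurableTypeR R) : measurableTypeR R :=
  k * x + c.

Lemma measurable_affine (k c : R) : measurable_fun setT (affine k c).
Proof. by apply: measurable_funD => //; exact: measurable_funM. Qed.

(** By uniqueness of Lebesgue measure: the scaled pushforward [nu] gives half-open intervals their
    length. *)
Lemma lebesgue_measure_affine (k c : R) (A : set R) : 0 < k ->
  measurable A -> (k%:E * mu (affine k c @^-1` A) = mu A)%E.
Proof.
move=> k0 mA; have mf := measurable_affine k c.
unshelve refine (let nu : {measure set (measurableTypeR R) -> \bar R} :=
  mscale (NngNum (ltW k0)) (pushforward mu (affine k c)) in _); first exact: mf.
apply/esym/(lebesgue_measure_unique (mu := nu)) => //= _ [[a b]] _ <-.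
rewrite /nu /mscale /= /pushforward.
have -> : affine k c @^-1` `]a, b]%classic = `](a - c) / k, (b - c) / k]%classic.
  apply/seteqP; split => x /=; rewrite /affine !in_itv/=;
   by rewrite ltr_pdivrMr// ler_pdivlMr// [x * _]mulrC ltrBlDr lerBrDr.
rewrite !lebesgue_measure_itv/= !lte_fin ltr_pM2r ?invr_gt0// ltrD2r.
case: ifPn => _; last by rewrite mule0.
by rewrite -!EFinB -EFinM; congr EFin; field; rewrite gt_eqF.
Qed.

Lemma ge0_integral_affine (k c : R) (f : R -> \bar R) : 0 < k ->
  measurable_fun [set: R] f -> (forall x, 0 <= f x)%E ->
  (\int[mu]_x f x = k%:E * \int[mu]_x f (k * x + c)%R)%E.
Proof.
move=> k0 mf f0.
have ma := measurable_affine k c.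
unshelve refine (let nu : {measure set (measurableTypeR R) -> \bar R} :=
  pushforward mu (affine k c) in _); first exact: ma.
transitivity (\int[mscale (NngNum (ltW k0)) nu]_x f x)%E.
  by apply: eq_measure_integral => A mA _; exact/esym/lebesgue_measure_affine.
by rewrite ge0_integral_mscale//= ge0_integral_pushforward.
Qed.

End affine_substitution.

(** * Rotation invariance of the plane Gaussian measure *)

Section gaussian_plane.
Context {R : realType}.
Local Notation mu := (@lebesgue_measure R).
Local Open Scope ereal_scope.

Lemma lebesgue_tonelli (f : R * R -> \bar R) :
  measurable_fun [set: R * R] f -> (forall z, 0 <= f z) ->
  \int[mu]_x \int[mu]_y f (x, y) = \int[mu]_y \int[mu]_x f (x, y).
Proof. by move=> mf f0; have := fubini_tonelli (m1 := mu) (m2 := mu) f mf f0. Qed.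

(** On each line of constant [x] the shear is a translation. The other shear reduces to the same
    fact once Tonelli has exchanged the integrals. *)
Lemma ge0_integral_shear2 (t : R) (f : R * R -> \bar R) :
  measurable_fun [set: R * R] f -> (forall z, 0 <= f z) ->
  \int[mu]_x \int[mu]_y f (x, (y + t * x)%R) = \int[mu]_x \int[mu]_y f (x, y).
Proof.
move=> mf f0; apply: eq_integral => x _.
rewrite [RHS](@ge0_integral_affine _ 1%R (t * x)%R)//; last exact: measurableT_comp.
by rewrite mul1e; apply: eq_integral => y _; rewrite mul1r.
Qed.

Lemma ge0_integral_shear1 (t : R) (f : R * R -> \bar R) :
  measurable_fun [set: R * R] f -> (forall z, 0 <= f z) ->
  \int[mu]_x \int[mu]_y f ((x + t * y)%R, y) = \int[mu]_x \int[mu]_y f (x, y).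
Proof.
move=> mf f0.
have mft : measurable_fun [set: R * R] (fun z : R * R => f ((z.1 + t * z.2)%R, z.2)).
  apply: (measurableT_comp mf); apply: measurable_fun_pair => //=.
  by apply: measurable_funD => //=; exact: measurable_funM.
transitivity (\int[mu]_y \int[mu]_x f ((x + t * y)%R, y)).
  exact: (lebesgue_tonelli mft (fun z => f0 _)).
transitivity (\int[mu]_y \int[mu]_x f (x, y)); last first.
  exact: (esym (lebesgue_tonelli mf f0)).
apply: eq_integral => y _.
rewrite [RHS](@ge0_integral_affine _ 1%R (t * y)%R)//; last exact: measurableT_comp.
by rewrite mul1e; apply: eq_integral => x _; rewrite mul1r.
Qed.

(* A rotation is a product of three shears, of slopes -t, s and -t where t is the
   tangent of the half-angle; hence the excluded half-turn c = -1. *)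
Lemma ge0_integral_rotation (c s : R) (f : R * R -> \bar R) :
  (c ^+ 2 + s ^+ 2 = 1)%R -> (c != -1)%R ->
  measurable_fun [set: R * R] f -> (forall z, 0 <= f z) ->
  \int[mu]_x \int[mu]_y f ((c * x - s * y)%R, (s * x + c * y)%R) =
  \int[mu]_x \int[mu]_y f (x, y).
Proof.
move=> cs1 c1 mf f0; pose t := (s / (1 + c))%R.
have c10 : (1 + c != 0)%R by rewrite addrC -[X in (c + X)%R]opprK subr_eq0.
(* The half-angle identities [ts] and [tc] identify the composite of the three shears with the
   rotation. *)
have ts : (t * s = 1 - c)%R.
  rewrite /t mulrAC -expr2 (_ : (s ^+ 2 = (1 - c) * (1 + c))%R) ?mulfK//.
  by rewrite -[(s ^+ 2)%R](addKr (c ^+ 2)%R) cs1; ring.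
have tc : (t * (1 + c) = s)%R by rewrite /t divfK.
have mshear1 : measurable_fun [set: R * R]
    (fun z : R * R => f ((z.1 + - t * z.2)%R, z.2)).
  apply: (measurableT_comp mf); apply: measurable_fun_pair => //=.
  by apply: measurable_funD => //=; exact: measurable_funM.
have mshear2 : measurable_fun [set: R * R]
    (fun z : R * R => f ((z.1 + - t * (z.2 + s * z.1))%R, (z.2 + s * z.1)%R)).
  apply: (measurableT_comp mf); apply: measurable_fun_pair => //=.
    apply: measurable_funD => //=; apply: measurable_funM => //.
    by apply: measurable_funD => //=; exact: measurable_funM.
  by apply: measurable_funD => //=; exact: measurable_funM.
have e1 := ge0_integral_shear1 (- t) mf f0.
have e2 := ge0_integral_shear2 s mshear1 (fun z => f0 _).
have e3 := ge0_integral_shear1 (- t) mshear2 (fun z => f0 _).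
apply: (etrans _ (etrans e3 (etrans e2 e1))) => /=.
apply: eq_integral => x _; apply: eq_integral => y _; congr (f (_, _)).
  transitivity (x - (t * s) * x - (t * (1 + (1 - t * s))) * y)%R; last by ring.
  by rewrite ts (_ : (1 - (1 - c) = c)%R) ?tc; ring.
transitivity (s * x + (1 - t * s) * y)%R; last by ring.
by rewrite ts; ring.
Qed.

Variable sigma : R.
Hypothesis sigma_gt0 : (0 < sigma)%R.
Local Notation phi := (normal_pdf 0 sigma).
Local Notation N := (normal_prob 0 sigma).

Let mphi : measurable_fun [set: R] (EFin \o phi).
Proof. by apply/measurable_EFinP; exact: measurable_normal_pdf. Qed.

(** The Radon-Nikodym derivative of [N] and the explicit density [phi] have the same integral over
    every measurable set, hence agree almost everywhere. *)
Lemma ge0_integral_normal_prob (f : R -> \bar R) :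
  measurable_fun [set: R] f -> (forall x, 0 <= f x) ->
  \int[N]_x f x = \int[mu]_x (f x * (phi x)%:E).
Proof.
move=> mf f0; have Nmu := normal_prob_dominates 0 sigma.
rewrite -(Radon_Nikodym_SigmaFinite.change_of_variables Nmu f0 measurableT mf).
have mRN := measurable_int _ (Radon_Nikodym_SigmaFinite.f_integrable Nmu).
apply: ae_eq_integral => //.
- exact: emeasurable_funM.
- exact: emeasurable_funM.
apply: ae_eqe_mul2l; apply: integral_ae_eq => //.
  exact: Radon_Nikodym_SigmaFinite.f_integrable.
by move=> E _ mE; rewrite -Radon_Nikodym_SigmaFinite.f_integral.
Qed.

Lemma ge0_integral_normal_prob2 (f : R * R -> \bar R) :
  measurable_fun [set: R * R] f -> (forall z, 0 <= f z) ->
  \int[N]_x \int[N]_y f (x, y) =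
  \int[mu]_x \int[mu]_y (f (x, y) * (phi x * phi y)%:E).
Proof.
move=> mf f0; rewrite ge0_integral_normal_prob.
- apply: eq_integral => x _.
  rewrite ge0_integral_normal_prob//; last exact: measurableT_comp.
  rewrite -ge0_integralZr//.
  + by apply: eq_integral => y _; rewrite -muleA -EFinM [(phi y * _)%R]mulrC.
  + by apply: emeasurable_funM => //; exact: measurableT_comp.
  + by move=> y _; rewrite mule_ge0// lee_fin normal_pdf_ge0.
  + by rewrite lee_fin normal_pdf_ge0.
- by have := measurable_fun_fubini_tonelli_F (m2 := N) f mf f0.
- by move=> x; exact: integral_ge0.
Qed.

(** The product density depends on [x ^+ 2 + y ^+ 2] only. *)
Lemma normal_pdf_rotation (c s x y : R) : (c ^+ 2 + s ^+ 2 = 1)%R ->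
  (phi (c * x - s * y) * phi (s * x + c * y) = phi x * phi y)%R.
Proof.
move=> cs1; rewrite !normal_pdfE ?gt_eqF// /normal_fun !subr0.
rewrite mulrACA -expRD [RHS]mulrACA -expRD; congr (_ * expR _)%R.
rewrite -!mulrDl; congr (_ / _)%R.
transitivity (- ((c ^+ 2 + s ^+ 2) * (x ^+ 2 + y ^+ 2)))%R; first by ring.
by rewrite cs1; ring.
Qed.

Lemma gaussian_rotation (c s : R) (f : R * R -> \bar R) :
  (c ^+ 2 + s ^+ 2 = 1)%R -> (c != -1)%R ->
  measurable_fun [set: R * R] f -> (forall z, 0 <= f z) ->
  \int[N]_x \int[N]_y f ((c * x - s * y)%R, (s * x + c * y)%R) =
  \int[N]_x \int[N]_y f (x, y).
Proof.
move=> cs1 c1 mf f0.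
rewrite (ge0_integral_normal_prob2 (f := fun z : R * R =>
  f ((c * z.1 - s * z.2)%R, (s * z.1 + c * z.2)%R)))//=; last first.
  apply: (measurableT_comp mf); apply: measurable_fun_pair => //=.
    by apply: measurable_funB => //=; exact: measurable_funM.
  by apply: measurable_funD => //=; exact: measurable_funM.
refine (etrans _ (esym (ge0_integral_normal_prob2 mf f0))).
rewrite -(ge0_integral_rotation (f := fun z : R * R =>
  f z * (phi z.1 * phi z.2)%:E) cs1 c1)/=.
- by do 2 (apply: eq_integral => ? _); rewrite normal_pdf_rotation// -surjective_pairing.
- apply: emeasurable_funM => //; apply/measurable_EFinP.
  by apply: measurable_funM; apply: measurableT_comp => //; exact: measurable_normal_pdf.
- by move=> z; rewrite mule_ge0// lee_fin mulr_ge0 ?normal_pdf_ge0.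
Qed.

End gaussian_plane.

(** * Radial and angular integrals *)

Section sector_integrals.
Context {R : realType}.
Local Notation mu := (@lebesgue_measure R).
Local Open Scope ereal_scope.

Lemma in_mkset (T : Type) (b : pred T) (x : T) : (x \in [set y | b y]) = b x.
Proof. by apply/idP/idP; rewrite inE. Qed.

Lemma measurable_natr_bool d (T : measurableType d) (b : T -> bool) :
  measurable_fun setT b ->
  measurable_fun [set: T] (fun z => ((b z)%:R : R)%:E).
Proof.
move=> mb; rewrite (_ : (fun z => _) = fun z => if b z then 1%:E else 0%:E).
  exact: measurable_fun_ifT.
by apply/funext => z; case: (b z).
Qed.

(** This is the radial integral left by the substitution [y = x s]; the factor [x] is the Jacobian,
    and it makes the primitive [F] elementary. *)
Lemma integral_mulr_gauss (a : R) : (0 < a)%R ->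
  \int[mu]_(x in `[0%R, +oo[) (x * expR (- (a * x ^+ 2)))%:E =
  ((2 * a)^-1)%:E.
Proof.
move=> a0; pose F (x : R) := (- (2 * a)^-1 * expR (- (a * x ^+ 2)))%R.
have dF (x : R) : is_derive x 1%R F (x * expR (- (a * x ^+ 2)))%R.
  rewrite /F; apply: is_derive_eq.
  by rewrite /GRing.scale/=; field; rewrite gt_eqF.
have cf : continuous (fun x : R => x * expR (- (a * x ^+ 2)))%R.
  by move=> x; apply/differentiable_continuous/derivable1_diffP; apply: ex_derive.
have cF : F x @[x --> +oo%R] --> (0 : R)%R.
  rewrite -(mulr0 (- (2 * a)^-1)%R); apply: cvgM; first exact: cvg_cst.
  apply: (cvg_comp (fun x => a * x ^+ 2)%R (fun x => expR (- x))); last exact: cvgr_expR.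
  by apply: gt0_cvgMry => //; exact: cvgr_expr2.
rewrite (ge0_continuous_FTC2y _ _ cF).
- by rewrite /F expr0n mulr0 oppr0 expR0 mulr1 sub0e -EFinN opprK.
- by move=> x x0; rewrite mulr_ge0 ?expR_ge0.
- exact: continuous_subspaceT.
- by move=> x _; apply: ex_derive.
- apply: cvg_at_right_filter; apply: differentiable_continuous.
  by apply/derivable1_diffP; apply: ex_derive.
- by move=> x _; rewrite derive1E; exact: derive_val.
Qed.

(** This is the integral over the slope [s]; the constant [4^-1] is the limit of the primitive at
    infinity, [(2 * pi)^-1] times [pi / 2]. *)
Lemma integral_oneDsqrV_itvy (t : R) :
  \int[mu]_(s in `[(- t)%R, +oo[) ((2 * pi)^-1 / (1 + s ^+ 2))%:E =
  (4^-1 + atan t / (2 * pi))%:E.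
Proof.
have pi0 := pi_gt0 R.
pose F (x : R) := ((2 * pi)^-1 * atan x)%R.
have cF : F x @[x --> +oo%R] --> ((2 * pi)^-1 * (pi / 2) : R)%R.
  by apply: cvgM; [exact: cvg_cst|exact: cvgy_atan].
have cf : continuous (fun s : R => (2 * pi)^-1 / (1 + s ^+ 2))%R.
  move=> x; apply: cvgM; first exact: cvg_cst. exact: continuous_oneDsqrV.
rewrite (ge0_continuous_FTC2y _ _ cF).
- rewrite -EFinB /F atanN; congr EFin.
  by move: (pi : R) (atan t) pi0 => q a q0; field; rewrite gt_eqF.
- move=> x _; rewrite divr_ge0 ?invr_ge0 ?addr_ge0 ?sqr_ge0//.
  by rewrite mulr_ge0// ltW.
- exact: continuous_subspaceT.
- by move=> x _; apply: ex_derive.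
- by apply: cvg_at_right_filter; apply: cvgM; [exact: cvg_cst|exact: continuous_atan].
- move=> x _; rewrite derive1E; rewrite derive_val.
  by rewrite /GRing.scale/=; ring.
Qed.

End sector_integrals.

(** * Gaussian measure of a planar sector *)

Section plane_sector.
Context {R : realType} (sigma : R).
Hypothesis sigma_gt0 : (0 < sigma)%R.
Local Notation mu := (@lebesgue_measure R).
Local Notation phi := (normal_pdf 0 sigma).
Local Notation N := (normal_prob 0 sigma).
Local Open Scope ereal_scope.

Lemma integral_itvcy_natr (a : R) (h : R -> R) :
  \int[mu]_(x in `[a, +oo[) (h x)%:E = \int[mu]_x ((a <= x)%R%:R * h x)%:E.
Proof.
rewrite integral_mkcond; apply: eq_integral => x _.
rewrite patchE mem_setE in_itv/= andbT.
by case: ifPn; rewrite ?mul1r ?mul0r.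
Qed.

Lemma integral_mulr_normal_pdf2 (s : R) :
  \int[mu]_(x in `[0%R, +oo[) (x * (phi x * phi (x * s)))%:E =
  ((2 * pi)^-1 / (1 + s ^+ 2))%:E.
Proof.
have s2 : (0 < 1 + s ^+ 2)%R by rewrite ltr_pwDl// sqr_ge0.
(* [a] is the decay rate of the product density along the ray [y = x s]; [sigma] cancels between
   [(2 * a)^-1] and the squared peak. *)
pose a := ((1 + s ^+ 2) / (sigma ^+ 2 *+ 2))%R.
have a0 : (0 < a)%R by rewrite divr_gt0// pmulrn_rgt0// exprn_gt0.
transitivity (\int[mu]_(x in `[0%R, +oo[)
    ((normal_peak sigma ^+ 2)%:E * (x * expR (- (a * x ^+ 2)))%:E)).
  apply: eq_integral => x _; rewrite -EFinM; congr EFin.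
  rewrite !normal_pdfE ?gt_eqF// /normal_fun !subr0.
  rewrite [(_ * _ * (_ * _))%R]mulrACA -expRD -expr2 mulrCA; congr (_ * (_ * expR _))%R.
  by rewrite /a; field; rewrite gt_eqF.
rewrite ge0_integralZl//.
- rewrite integral_mulr_gauss// -EFinM; congr EFin.
  rewrite /normal_peak exprVn sqr_sqrtr; last first.
    by rewrite mulrn_wge0// mulr_ge0 ?sqr_ge0// pi_ge0.
  rewrite /a; move: (pi : R) (pi_gt0 R) => q q0; field.
  by rewrite !gt_eqF.
- apply/measurable_EFinP/measurable_funTS/measurable_funM => //.
  apply: measurableT_comp => //; apply: measurableT_comp => //.
  by apply: measurable_funM => //; exact: measurable_funX.
- by move=> x; rewrite /= in_itv/= andbT => x0; rewrite lee_fin mulr_ge0 ?expR_ge0.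
- by rewrite lee_fin sqr_ge0.
Qed.

(** The region is the sector between the angles [- atan t] and [pi / 2], and its mass is its opening
    angle divided by [2 * pi]. *)
Lemma gaussian_sector (t : R) :
  \int[N]_x \int[N]_y (((0 <= x) && (- t * x <= y))%R%:R)%:E =
  (4^-1 + atan t / (2 * pi))%:E.
Proof.
pose f (z : R * R) : \bar R := (((0 <= z.1) && (- t * z.1 <= z.2))%R%:R)%:E.
have mf : measurable_fun [set: R * R] f.
  apply: measurable_natr_bool; apply: measurable_and.
    exact: measurable_fun_ler.
  by apply: measurable_fun_ler => //; exact: measurable_funM.
have f0 z : 0 <= f z by rewrite lee_fin ler0n.
(* The second coordinate of [g] is the slope [s]: this is the weighted integrand at [y = x s],
   multiplied by the Jacobian [x]. *)
pose g (z : R * R) : \bar R := (((0 <= z.1) && (- t <= z.2))%R%:R *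
  (z.1 * (phi z.1 * phi (z.1 * z.2))))%:E.
have mphi2 : measurable_fun [set: R * R] (fun z : R * R => phi z.1 * phi z.2)%R.
  by apply: measurable_funM; apply: measurableT_comp => //; exact: measurable_normal_pdf.
have mg : measurable_fun [set: R * R] g.
  apply/measurable_EFinP; apply: measurable_funM.
    apply/measurable_EFinP; apply: measurable_natr_bool; apply: measurable_and.
      exact: measurable_fun_ler.
    exact: measurable_fun_ler.
  apply: measurable_funM => //; apply: measurable_funM.
    by apply: measurableT_comp => //; exact: measurable_normal_pdf.
  apply: measurableT_comp; first exact: measurable_normal_pdf.
  exact: measurable_funM.
have g0 z : 0 <= g z.
  rewrite lee_fin; case: (lerP 0 z.1) => /= z1; last by rewrite mul0r.
  by rewrite mulr_ge0// mulr_ge0// mulr_ge0// normal_pdf_ge0.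
pose fphi (z : R * R) : \bar R := f z * (phi z.1 * phi z.2)%:E.
have mfphi : measurable_fun [set: R * R] fphi.
  by apply: emeasurable_funM => //; exact/measurable_EFinP.
have fphi0 z : 0 <= fphi z by rewrite mule_ge0// lee_fin mulr_ge0 ?normal_pdf_ge0.
refine (etrans (ge0_integral_normal_prob2 sigma mf f0) _).
(* Substitute y = x s; the two sides differ only on the null set x = 0. *)
transitivity (\int[mu]_x \int[mu]_y g (x, y)).
  apply: ae_eq_integral => //.
  - by have := measurable_fun_fubini_tonelli_F (m2 := mu) fphi mfphi fphi0.
  - by have := measurable_fun_fubini_tonelli_F (m2 := mu) g mg g0.
  - exists [set 0%R]; split => //; first exact: lebesgue_measure_set1.
    move=> x /= /not_implyP[_]; apply: contra_notP => /eqP x0.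
    have [{}x0|{}x0|xE] := ltrgtP x 0%R; last by rewrite xE eqxx in x0.
      apply: eq_integral => y _; rewrite /f /g/= leNgt x0/=.
      by rewrite mul0e mul0r.
    have mfx : measurable_fun [set: R] (fun y => fphi (x, y)) by exact: measurableT_comp.
    apply: etrans (ge0_integral_affine 0%R x0 mfx (fun y => fphi0 (x, y))) _.
    pose h (y : R) := fphi (x, (x * y + 0)%R).
    have mh : measurable_fun [set: R] h.
      apply: (measurableT_comp mfphi); apply: measurable_fun_pair => //.
      by apply: measurable_funD => //; exact: measurable_funM.
    have xE : 0 <= x%:E by rewrite lee_fin ltW.
    apply: etrans (esym (ge0_integralZl mu measurableT mh (fun y _ => fphi0 _) xE)) _.
    apply: eq_integral => y _; rewrite /h addr0 /fphi /f /g/= ltW//=.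
    by rewrite (mulrC (- t)%R) ler_pM2l// -!EFinM mulrCA.
(* With the order exchanged, the inner integral over [x] is [integral_mulr_normal_pdf2] and the
   outer one over [s] is [integral_oneDsqrV_itvy]. *)
refine (etrans (lebesgue_tonelli mg g0) _).
rewrite -integral_oneDsqrV_itvy integral_itvcy_natr.
apply: eq_integral => s _.
rewrite EFinM -integral_mulr_normal_pdf2 integral_itvcy_natr.
have sE : 0 <= ((- t <= s)%R%:R : R)%:E by rewrite lee_fin ler0n.
pose h (x : R) : \bar R := ((0 <= x)%R%:R * (x * (phi x * phi (x * s))))%:E.
have h0 x : 0 <= h x.
  rewrite lee_fin; case: (lerP 0 x) => /= x0; last by rewrite mul0r.
  by rewrite mul1r mulr_ge0// mulr_ge0// normal_pdf_ge0.
have mh : measurable_fun [set: R] h.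
  apply/measurable_EFinP; apply: measurable_funM.
    apply/measurable_EFinP; apply: measurable_natr_bool.
    exact: measurable_fun_ler.
  apply: measurable_funM => //; apply: measurable_funM.
    exact: measurable_normal_pdf.
  apply: measurableT_comp; first exact: measurable_normal_pdf.
  exact: measurable_funM.
apply: etrans (ge0_integralZl mu measurableT mh (fun y _ => h0 y) sE).
by apply: eq_integral => x _; rewrite /g/= -mulnb natrM -EFinM -mulrA mulrCA.
Qed.

End plane_sector.

(** * Values of the arcsine *)

Section asin_values.
Context {R : realType}.
Implicit Types t : R.

Lemma asin0 : asin 0 = 0 :> R.
Proof.
rewrite -[X in asin X]sin0 sinK// in_itv/= oppr_le0 andbb.
by rewrite divr_ge0// pi_ge0.
Qed.

Lemma asin1 : asin 1 = pi / 2 :> R.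
Proof.
rewrite -[RHS]sinK ?sin_pihalf// in_itv/= lexx andbT.
by rewrite ge0_cp// divr_ge0// pi_ge0.
Qed.

Lemma asinN1 : asin (- 1) = - (pi / 2) :> R.
Proof.
rewrite -[RHS]sinK ?sinN ?sin_pihalf// in_itv/= lexx/=.
by rewrite ge0_cp// divr_ge0// pi_ge0.
Qed.

(** The argument is [sin (atan t)]. This converts the slope of the edge of a sector into a
    correlation. *)
Lemma asin_atan t : asin (t / Num.sqrt (1 + t ^+ 2)) = atan t.
Proof.
have cos_neq0 : cos (atan t) != 0.
  by rewrite cos_atan invr_eq0 gt_eqF// sqrtr_gt0 ltr_pwDl// sqr_ge0.
have -> : t / Num.sqrt (1 + t ^+ 2) = sin (atan t).
  by rewrite -cos_atan -{1}[t]atanK /tan divfK.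
by rewrite sinK// in_itv/= !ltW ?atan_gtNpi2 ?atan_ltpi2.
Qed.

End asin_values.

(** * Gaussian measure of an intersection of two half-planes *)

Section plane_quadrant.
Context {R : realType} (sigma : R).
Hypothesis sigma_gt0 : (0 < sigma)%R.
Local Notation mu := (@lebesgue_measure R).
Local Notation phi := (normal_pdf 0 sigma).
Local Notation N := (normal_prob 0 sigma).
Local Open Scope ereal_scope.

Lemma integral_normal_prob_cst (r : \bar R) : \int[N]_x r = r.
Proof.
rewrite (integral_cst N)//.
exact: etrans (congr1 (mule r) (probability_setT N)) (mule1 r).
Qed.

(** The half-turn is the case excluded from [gaussian_rotation], so it is performed as two
    quarter-turns. *)
Lemma gaussian_oppr (f : R * R -> \bar R) :
  measurable_fun [set: R * R] f -> (forall z, 0 <= f z) ->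
  \int[N]_x \int[N]_y f ((- x)%R, (- y)%R) = \int[N]_x \int[N]_y f (x, y).
Proof.
move=> mf f0.
have e : (0 ^+ 2 + 1 ^+ 2 = 1 :> R)%R by rewrite expr0n expr1n add0r.
have ne : (0 != -1 :> R)%R by rewrite eq_sym oppr_eq0 oner_eq0.
have e1 := gaussian_rotation sigma_gt0 e ne mf f0.
have mf' : measurable_fun [set: R * R]
    (fun z : R * R => f ((0 * z.1 - 1 * z.2)%R, (1 * z.1 + 0 * z.2)%R)).
  apply: (measurableT_comp mf); apply: measurable_fun_pair => //=.
    by apply: measurable_funB => //=; exact: measurable_funM.
  by apply: measurable_funD => //=; exact: measurable_funM.
have e2 := gaussian_rotation sigma_gt0 e ne mf' (fun z => f0 _).
refine (etrans _ (etrans e2 e1)).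
apply: eq_integral => x _; apply: eq_integral => y _ /=; congr (f (_, _)); ring.
Qed.

Lemma normal_prob_halfline : \int[N]_x ((0 <= x)%R%:R)%:E = (2^-1)%:E.
Proof.
have mb : measurable_fun [set: R] (fun x => ((0 <= x)%R%:R : R)%:E).
  by apply: measurable_natr_bool; exact: measurable_fun_ler.
refine (etrans (ge0_integral_normal_prob sigma mb _) _).
  by move=> x; rewrite lee_fin ler0n.
rewrite -(integral_itvcy_natr 0%R phi) set_itvcy.
have := ge0_symfun_integralT (normal_pdf_ge0 0%R sigma)
  (@continuous_normal_pdf _ _ _ (lt0r_neq0 sigma_gt0)).
rewrite integral_normal_pdf => half.
have sym : phi =1 phi \o -%R.
  by move=> x; rewrite /= !normal_pdfE ?gt_eqF// /normal_fun !subr0 sqrrN.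
(* Twice the half-line integral is the total mass 1, so the infinite values are impossible. *)
move: half => /(_ sym); case: (\int[mu]_(x in _) _) => [r|/=|/=].
- by rewrite -EFinM => -[r1]; congr EFin; lra.
- by rewrite gt0_muley// lte_fin.
- by rewrite gt0_muleNy// lte_fin.
Qed.

(** A point reflection turns the first condition into [0 <= x] and, for [0 < c], the second into
    [- (b / c) * x <= y], which is a sector. The argument of [asin] is the correlation of the two
    forms. *)
Lemma gaussian_quadrant (a b c : R) : (0 < a)%R -> (0 <= c)%R ->
  (0 < b ^+ 2 + c ^+ 2)%R ->
  \int[N]_x \int[N]_y (((a * x <= 0) && (b * x + c * y <= 0))%R%:R)%:E =
  (4^-1 + asin (b / Num.sqrt (b ^+ 2 + c ^+ 2)) / (2 * pi))%:E.
Proof.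
move=> a0 c0 bc0; have pi0 := pi_gt0 R.
pose f (z : R * R) : \bar R := (((a * z.1 <= 0) && (b * z.1 + c * z.2 <= 0))%R%:R)%:E.
have mf : measurable_fun [set: R * R] f.
  apply: measurable_natr_bool; apply: measurable_and.
    by apply: measurable_fun_ler => //; exact: measurable_funM.
  by apply: measurable_fun_ler => //; apply: measurable_funD; exact: measurable_funM.
have f0 z : 0 <= f z by rewrite lee_fin ler0n.
refine (etrans (esym (gaussian_oppr mf f0)) _); rewrite /f/=.
have aE (x : R) : (a * - x <= 0)%R = (0 <= x)%R by rewrite pmulr_rle0// oppr_le0.
move: c0; rewrite le0r => /orP[/eqP cE|c0]; last first.
  have -> : asin (b / Num.sqrt (b ^+ 2 + c ^+ 2)) = atan (b / c).
    rewrite -asin_atan; congr asin.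
    have -> : (b ^+ 2 + c ^+ 2 = c ^+ 2 * (1 + (b / c) ^+ 2))%R.
      by field; rewrite gt_eqF.
    rewrite sqrtrM ?sqr_ge0// sqrtr_sqr gtr0_norm// invfM.
    by rewrite mulrA.
  rewrite -(gaussian_sector sigma_gt0).
  apply: eq_integral => x _; apply: eq_integral => y _; rewrite aE.
  congr ((_ && _)%:R%:E).
  have -> : (- (b / c) * x = - (b * x) / c)%R by ring.
  by rewrite ler_pdivrMr//; apply/idP/idP => ?; lra.
(* For [c = 0] the forms are proportional: the half-planes coincide if [0 < b], and meet in the null
   line [x = 0] if [b < 0]. *)
move: bc0; rewrite cE expr0n addr0 => b2.
have bN0 : (b != 0)%R by apply: contraTneq b2 => ->; rewrite expr0n ltxx.
rewrite sqrtr_sqr.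
have -> : \int[N]_x \int[N]_y (((a * - x <= 0) && (b * - x + 0 * - y <= 0))%R%:R)%:E =
    \int[N]_x (((0 <= x) && (b * - x <= 0))%R%:R)%:E.
  apply: eq_integral => x _; rewrite aE.
  under eq_integral do rewrite mul0r addr0.
  exact: integral_normal_prob_cst.
have [b0|b0] := ltrP 0 b.
  rewrite gtr0_norm// divff ?gt_eqF// asin1.
  transitivity (2^-1%:E : \bar R); last first.
    by congr EFin; move: (pi : R) pi0 => q q0; field; rewrite gt_eqF.
  rewrite -normal_prob_halfline; apply: eq_integral => x _.
  by rewrite pmulr_rle0// oppr_le0 andbb.
have {}b0 : (b < 0)%R by rewrite lt_neqAle bN0.
rewrite ltr0_norm// invrN mulrN divff ?lt_eqF// asinN1.
transitivity (0%:E : \bar R); last first.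
  by congr EFin; move: (pi : R) pi0 => q q0; field; rewrite gt_eqF.
transitivity (\int[N]_x (\1_[set 0%R] x)%:E).
  apply: eq_integral => x _; rewrite indicE; congr (_%:R%:E).
  by rewrite nmulr_rle0// oppr_ge0 -eq_le eq_sym classical_sets.in_set1.
rewrite integral_indic// setIT.
have /null_content_dominatesP := normal_prob_dominates 0 sigma.
move=> /(_ [set 0%R] (measurable_set1 _)).
by apply; exact: lebesgue_measure_set1.
Qed.

End plane_quadrant.

(** * Absorbing a third Gaussian coordinate by Givens rotations *)

Section gaussian_givens.
Context {R : realType} (sigma : R).
Hypothesis sigma_gt0 : (0 < sigma)%R.
Local Notation N := (normal_prob 0 sigma).
Local Open Scope ereal_scope.

(** The rotation takes [(u, v)] to the first axis. The bound [0 <= c], inherited from [0 <= u],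
    keeps it away from the half-turn. *)
Lemma givens (u v : R) : (0 <= u)%R -> exists c s : R,
  [/\ (c ^+ 2 + s ^+ 2 = 1)%R, (0 <= c)%R,
      (u * c + v * s = Num.sqrt (u ^+ 2 + v ^+ 2))%R & (v * c = u * s)%R].
Proof.
move=> u0; have [uv0|uv0] := eqVneq (u ^+ 2 + v ^+ 2)%R 0%R.
  exists 1%R, 0%R; rewrite uv0 sqrtr0.
  move: uv0 => /eqP; rewrite paddr_eq0 ?sqr_ge0// !sqrf_eq0 => /andP[/eqP -> /eqP ->].
  by rewrite expr1n expr0n !mul0r !addr0.
have uv : (0 < u ^+ 2 + v ^+ 2)%R by rewrite lt0r uv0 addr_ge0 ?sqr_ge0.
set r := Num.sqrt _; have r0 : (0 < r)%R by rewrite sqrtr_gt0.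
have rE : (r ^+ 2 = u ^+ 2 + v ^+ 2)%R by rewrite sqr_sqrtr// ltW.
exists (u / r)%R, (v / r)%R; split.
- by rewrite !expr_div_n -mulrDl -rE divff// expf_neq0// gt_eqF.
- by rewrite divr_ge0// ltW.
- by rewrite !mulrA -mulrDl -!expr2 -rE expr2 mulfK// gt_eqF.
- by rewrite mulrCA !mulrA.
Qed.

Lemma normal_tonelli (f : R * R -> \bar R) :
  measurable_fun [set: R * R] f -> (forall z, 0 <= f z) ->
  \int[N]_x \int[N]_y f (x, y) = \int[N]_y \int[N]_x f (x, y).
Proof.
by move=> mf f0; have := fubini_tonelli (m1 := N) (m2 := N) f mf f0.
Qed.

(** Brings [x] next to [z], so that a rotation of the [(x, z)]-plane acts on the two innermost
    integrals. *)
Lemma normal_tonelli3 (f : R * R * R -> \bar R) :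
  measurable_fun [set: R * R * R] f -> (forall z, 0 <= f z) ->
  \int[N]_x \int[N]_y \int[N]_z f (x, y, z) =
  \int[N]_y \int[N]_x \int[N]_z f (x, y, z).
Proof.
move=> mf f0; pose g (p : R * R) : \bar R := \int[N]_z f (p, z).
have mg : measurable_fun [set: R * R] g.
  by have := measurable_fun_fubini_tonelli_F (m2 := N) f mf f0.
exact: (normal_tonelli mg (fun p => integral_ge0 _ (fun z _ => f0 _))).
Qed.

(* One Givens rotation in the (x, z)-plane, then one in the (y, z)-plane. *)
Lemma gaussian_add (a b c p q : R) : (0 <= a)%R -> (0 <= c)%R ->
  exists a' b' c' : R, [/\ (0 <= a')%R, (0 <= c')%R,
    [/\ (a' ^+ 2 = a ^+ 2 + p ^+ 2)%R,
        (a' * b' = a * b + p * q)%R &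
        (b' ^+ 2 + c' ^+ 2 = b ^+ 2 + c ^+ 2 + q ^+ 2)%R] &
    forall f : R * R -> \bar R,
      measurable_fun [set: R * R] f -> (forall z, 0 <= f z) ->
      \int[N]_x \int[N]_y \int[N]_z
         f ((a * x + p * z)%R, (b * x + c * y + q * z)%R) =
      \int[N]_x \int[N]_y f ((a' * x)%R, (b' * x + c' * y)%R)].
Proof.
move=> a0 c0.
have [k [s [ks1 k0 aE pE]]] := givens p a0.
(* The first rotation removes [z] from the first form; [b'] and [q'] are the resulting coefficients
   of [x] and [z] in the second form, and the next rotation removes [q']. *)
pose b' := (b * k + q * s)%R; pose q' := (q * k - b * s)%R.
have [l [t [lt1 l0 cE qE]]] := givens q' c0.
have kN1 : (k != -1)%R by rewrite gt_eqF// (lt_le_trans _ k0)// oppr_lt0.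
have lN1 : (l != -1)%R by rewrite gt_eqF// (lt_le_trans _ l0)// oppr_lt0.
pose a' := Num.sqrt (a ^+ 2 + p ^+ 2); pose c' := Num.sqrt (c ^+ 2 + q' ^+ 2).
rewrite -/a' in aE; rewrite -/c' in cE.
have a'E : (a' ^+ 2 = a ^+ 2 + p ^+ 2)%R by rewrite sqr_sqrtr// addr_ge0 ?sqr_ge0.
have c'E : (c' ^+ 2 = c ^+ 2 + q' ^+ 2)%R by rewrite sqr_sqrtr// addr_ge0 ?sqr_ge0.
(* Rotations preserve inner products of coefficient vectors; the defect term contains
   [a * s - p * k], which is zero by [pE]. *)
have abE : (a' * b' = a * b + p * q)%R.
  transitivity ((a * b + p * q) * (k ^+ 2 + s ^+ 2) + (a * s - p * k) * (q * k - b * s))%R.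
    by rewrite -aE /b'; ring.
  by rewrite ks1 pE; ring.
have bcE : (b' ^+ 2 + c' ^+ 2 = b ^+ 2 + c ^+ 2 + q ^+ 2)%R.
  transitivity ((b ^+ 2 + q ^+ 2) * (k ^+ 2 + s ^+ 2) + c ^+ 2)%R.
    by rewrite c'E /b' /q'; ring.
  by rewrite ks1; ring.
exists a', b', c'; split; [exact: sqrtr_ge0|exact: sqrtr_ge0|by []|].
move=> f mf f0.
pose f1 (w : R * R * R) : \bar R :=
  f ((a * w.1.1 + p * w.2)%R, (b * w.1.1 + c * w.1.2 + q * w.2)%R).
pose f2 (w : R * R * R) : \bar R :=
  f ((a' * w.1.1)%R, (b' * w.1.1 + c * w.1.2 + q' * w.2)%R).
have m1 : measurable_fun [set: R * R * R] (fun w : R * R * R => w.1.1).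
  exact: measurableT_comp.
have m2 : measurable_fun [set: R * R * R] (fun w : R * R * R => w.1.2).
  exact: measurableT_comp.
have mf1 : measurable_fun [set: R * R * R] f1.
  apply: (measurableT_comp mf); apply: measurable_fun_pair.
    by apply: measurable_funD; exact: measurable_funM.
  apply: measurable_funD; last exact: measurable_funM.
  by apply: measurable_funD; exact: measurable_funM.
have mf2 : measurable_fun [set: R * R * R] f2.
  apply: (measurableT_comp mf); apply: measurable_fun_pair.
    exact: measurable_funM.
  apply: measurable_funD; last exact: measurable_funM.
  by apply: measurable_funD; exact: measurable_funM.
refine (etrans (normal_tonelli3 mf1 (fun w => f0 _)) _).
transitivity (\int[N]_y \int[N]_x \int[N]_z f2 (x, y, z)).
  apply: eq_integral => y _.
  pose g (w : R * R) : \bar R := f1 (w.1, y, w.2).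
  have mg : measurable_fun [set: R * R] g.
    apply: (measurableT_comp mf1); apply: measurable_fun_pair => //.
    exact: measurable_fun_pair.
  refine (etrans (esym (gaussian_rotation sigma_gt0 ks1 kN1 mg (fun w => f0 _))) _).
  apply: eq_integral => x _; apply: eq_integral => z _.
  rewrite /g /f1 /f2/= -aE /b' /q'; congr (f (_, _)); last by ring.
  transitivity ((a * k + p * s) * x + (p * k - a * s) * z)%R; first by ring.
  by rewrite pE subrr mul0r addr0.
refine (etrans (esym (normal_tonelli3 mf2 (fun w => f0 _))) _).
apply: eq_integral => x _.
pose g (w : R * R) : \bar R := f2 (x, w.1, w.2).
have mg : measurable_fun [set: R * R] g.
  apply: (measurableT_comp mf2); apply: measurable_fun_pair => //.
  exact: measurable_fun_pair.
refine (etrans (esym (gaussian_rotation sigma_gt0 lt1 lN1 mg (fun w => f0 _))) _).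
apply: eq_integral => y _.
(* After the second rotation the integrand is constant in [z], which integrates out. *)
apply: etrans (integral_normal_prob_cst sigma _).
apply: eq_integral => z _.
rewrite /g /f2/= -cE; congr (f (_, _)).
transitivity (b' * x + (c * l + q' * t) * y + (q' * l - c * t) * z)%R; first by ring.
by rewrite qE subrr mul0r addr0.
Qed.

End gaussian_givens.

(** * Joint laws from their values on rectangles *)

Section joint_law.
Context d d1 d2 (T : measurableType d) (T1 : measurableType d1)
  (T2 : measurableType d2) (R : realType).
Variables (Q : {measure set T -> \bar R}).
Variables (m1 : {sigma_finite_measure set T1 -> \bar R})
          (m2 : {sigma_finite_measure set T2 -> \bar R}).
Variables (X : T -> T1) (Z : T -> T2).
Hypotheses (mX : measurable_fun setT X) (mZ : measurable_fun setT Z).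
Hypothesis XZ : forall A B, measurable A -> measurable B ->
  (Q (X @^-1` A `&` Z @^-1` B) = m1 A * m2 B)%E.

(** A measure that agrees with a product measure on rectangles equals it, and Tonelli evaluates the
    latter. [Q] is a general measure so that it can be a probability restricted to an event. *)
Lemma joint_law_product (C : set (T1 * T2)) : measurable C ->
  Q ((fun w => (X w, Z w)) @^-1` C) =
  (\int[m1]_x \int[m2]_z (\1_C (x, z))%:E)%E.
Proof.
move=> mC; have mXZ : measurable_fun setT (fun w => (X w, Z w)).
  exact: measurable_fun_pair.
unshelve refine (let Q' : {measure set (T1 * T2) -> \bar R} :=
  pushforward Q (fun w => (X w, Z w)) in _); first exact: mXZ.
transitivity ((m1 \x m2)%E C).
  by apply/esym/(@product_measure_unique _ _ _ _ _ m1 m2 Q').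
have mf : measurable_fun [set: T1 * T2] (fun z => (\1_C z : R)%:E).
  by apply/measurable_EFinP; exact: measurable_indic.
refine (etrans _ (fubini_tonelli1 (m1 := m1) (m2 := m2) _ mf _)).
  by rewrite integral_indic// setIT.
by move=> z; rewrite lee_fin indicE ler0n.
Qed.

End joint_law.

(** A Cholesky factor acting on a pair of independent Gaussians, the normal form for the law of two
    linear forms. *)
Definition triangular_map (R : realType) (a b c : R)
    (z : measurableTypeR R * measurableTypeR R) :
    measurableTypeR R * measurableTypeR R :=
  (a * z.1, b * z.1 + c * z.2).

Lemma measurable_triangular_map (R : realType) (a b c : R) :
  measurable_fun setT (triangular_map a b c).
Proof.
apply: measurable_fun_pair; first exact: measurable_funM.
by apply: measurable_funD; exact: measurable_funM.
Qed.

HB.instance Definition _ (R : realType) (a b c : R) :=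
  isMeasurableFun.Build _ _ _ _ (triangular_map a b c)
    (measurable_triangular_map a b c).

Lemma finite_integral_indic d (T : measurableType d) (R : realType)
    (m : {finite_measure set T -> \bar R}) (A : set T) : measurable A ->
  (\int[m]_z (\1_A z)%:E = m A)%E.
Proof. by move=> mA; rewrite integral_indic// setIT. Qed.

(** * Law of two linear forms in independent Gaussian variables *)

Section gaussian_linear_forms.
Context d (T : measurableType d) (R : realType) (P : probability T R).
Variables (sigma : R) (n : nat) (eps : 'I_n -> {RV P >-> R}).
Hypothesis sigma_gt0 : 0 < sigma.
Hypothesis hnormal : forall k, normally_distributed (eps k) 0 sigma.
Hypothesis hindep : mutually_independent eps.
Local Notation N := (normal_prob 0 sigma).

(** The truncation at [m] is what the induction on the number of variables runs over. *)
Definition linear_form (m : nat) (a : 'I_n -> R) (w : T) : R :=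
  \sum_(i < n | (i < m)%N) a i * eps i w.

Lemma measurable_linear_form m a : measurable_fun setT (linear_form m a).
Proof.
rewrite (_ : linear_form m a =
    \sum_(i < n | (i < m)%N) (fun w => a i * eps i w)); last first.
  by apply/funext => w; rewrite fct_sumE.
elim/big_ind: _ => [|f g mf mg|i _]; first exact: measurable_cst.
  exact: measurable_funD.
exact: measurable_funM.
Qed.

Lemma sum_ltnS (V : nmodType) (F : 'I_n -> V) (k : 'I_n) :
  \sum_(i < n | (i < k.+1)%N) F i = \sum_(i < n | (i < k)%N) F i + F k.
Proof.
rewrite (bigD1 k)//= addrC; congr (_ + _); apply: eq_bigl => i.
by rewrite ltnS ltn_neqAle andbC.
Qed.

Lemma bigcap_setU1 (J : {set 'I_n}) (k : 'I_n) (F : 'I_n -> set T) :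
  \bigcap_(i in [set` (k |: J)%SET]) F i = F k `&` \bigcap_(i in [set` J]) F i.
Proof.
apply/seteqP; split => w /=.
  move=> h; split; first by apply: h; rewrite /= finset.in_setU1 eqxx.
  by move=> i /= iJ; apply: h; rewrite /= finset.in_setU1 iJ orbT.
move=> [wk wJ] i /=; rewrite finset.in_setU1 => /orP[/eqP -> //|iJ].
exact: wJ.
Qed.

Let event (J : {set 'I_n}) (B : 'I_n -> set R) : set T :=
  \bigcap_(i in [set` J]) (eps i @^-1` B i).

Let measurable_event J B : (forall i, measurable (B i)) -> measurable (event J B).
Proof.
move=> mB; apply: fin_bigcap_measurable; first exact: finite_finset.
by move=> i _; rewrite -[_ @^-1` _]setTI; exact: measurable_funP.
Qed.

(* The event on the later variables eps_i, m <= i, carries the independence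
   through the induction on m. *)
Lemma partial_linear_forms_law (a b : 'I_n -> R) (m : nat) : (m <= n)%N ->
  exists u v t : R, [/\ 0 <= u, 0 <= t,
    [/\ u ^+ 2 = \sum_(i < n | (i < m)%N) a i ^+ 2,
        u * v = \sum_(i < n | (i < m)%N) a i * b i &
        v ^+ 2 + t ^+ 2 = \sum_(i < n | (i < m)%N) b i ^+ 2] &
    forall (J : {set 'I_n}) (B : 'I_n -> set R) (A : set (R * R)),
      (forall i, i \in J -> (m <= i)%N) -> (forall i, measurable (B i)) ->
      measurable A ->
      (P ((fun w => (linear_form m a w, linear_form m b w)) @^-1` A `&`
          event J B) =
       P (event J B) *
       \int[N]_x \int[N]_y (\1_A ((u * x)%R, (v * x + t * y)%R))%:E)%E].
Proof.
elim: m => [_|m IH mn].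
  exists 0, 0, 0; split => //; first by rewrite !big1// !mulr0 ?expr0n ?addr0.
  move=> J B A _ mB mA.
  under eq_integral do under eq_integral do rewrite !mul0r addr0.
  under eq_integral do rewrite integral_normal_prob_cst.
  rewrite integral_normal_prob_cst indicE.
  have -> : (fun w => (linear_form 0 a w, linear_form 0 b w)) @^-1` A =
      if (0, 0) \in A then setT else set0.
    have l0 c w : linear_form 0 c w = 0 by rewrite /linear_form big_pred0.
    by case: ifPn => h; apply/seteqP; split => w //=; rewrite !l0 => ?;
      move: h; rewrite ?notin_setE ?inE.
  by case: ifPn => _; rewrite ?setTI ?set0I ?mule1 ?mule0 ?measure0.
have [u [v [t [u0 t0 [uE uvE vtE] law]]]] := IH (ltnW mn).
pose k := Ordinal mn.
have [u' [v' [t' [u'0 t'0 [u'E u'v'E v't'E] addE]]]] :=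
  gaussian_add sigma_gt0 v (a k) (b k) u0 t0.
exists u', v', t'; split => //.
  by rewrite !(sum_ltnS _ k)/= u'E u'v'E v't'E uE uvE vtE.
move=> J B A mJ mB mA.
pose E := event J B; have mE : measurable E by exact: measurable_event.
have PEfin : P E \is a fin_num by rewrite fin_num_measure.
have PEge0 : 0 <= fine (P E) by rewrite fine_ge0.
(* [nu] is the law of the two partial sums on the event [E], as given by the induction hypothesis;
   its total mass is [P E]. *)
pose nu : {finite_measure set (measurableTypeR R * measurableTypeR R)%type -> \bar R} :=
  mscale (NngNum PEge0) (distribution (N \x N)%E (triangular_map u v t)).
have nuE (f : R * R -> \bar R) : measurable_fun [set: R * R] f ->
    (forall z, 0 <= f z)%E ->
    (\int[nu]_z f z = P E * \int[N]_x \int[N]_y f ((u * x)%R, (v * x + t * y)%R))%E.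
  move=> mf f0.
  rewrite ge0_integral_mscale//= fineK//; congr (_ * _)%E.
  rewrite ge0_integral_distribution//.
  refine (fubini_tonelli1 (m1 := N) (m2 := N) (f \o triangular_map u v t) _ _).
    exact: (measurableT_comp mf (measurable_triangular_map u v t)).
  by move=> z; exact: f0.
pose X w := (linear_form m a w, linear_form m b w).
have mX : measurable_fun setT X.
  by apply: measurable_fun_pair; exact: measurable_linear_form.
pose C : set (R * R * R) := [set z | A (z.1.1 + a k * z.2, z.1.2 + b k * z.2)].
have mC : measurable C.
  have mg : measurable_fun [set: R * R * R]
      (fun z : R * R * R => (z.1.1 + a k * z.2, z.1.2 + b k * z.2)).
    have m1 : measurable_fun [set: R * R * R] (fun w : R * R * R => w.1.1).
      exact: measurableT_comp.
    have m2 : measurable_fun [set: R * R * R] (fun w : R * R * R => w.1.2).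
      exact: measurableT_comp.
    by apply: measurable_fun_pair; apply: measurable_funD => //; exact: measurable_funM.
  by rewrite -[C]setTI; exact: mg.
have XZ (A' : set (R * R)) (B' : set R) : measurable A' -> measurable B' ->
    (mrestr P mE (X @^-1` A' `&` eps k @^-1` B') = nu A' * N B')%E.
  move=> mA' mB'.
  (* The induction hypothesis is applied to [E] enlarged by the condition that [eps k] lies in [B'].
     This changes nothing on [J], whose indices all exceed [k]. *)
  pose B2 i := if i == k then B' else B i.
  have mB2 i : measurable (B2 i) by rewrite /B2; case: ifPn.
  have kJ : k \notin J by apply/negP => /mJ; rewrite ltnn.
  have B2J i : i \in J -> B2 i = B i.
    by rewrite /B2; case: eqP => // -> kJ'; rewrite kJ' in kJ.
  have E2 : event (k |: J)%SET B2 = eps k @^-1` B' `&` E.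
    rewrite /event bigcap_setU1 {1}/B2 eqxx; congr (_ `&` _).
    by apply: eq_bigcapr => i iJ; rewrite B2J.
  have PE2 : P (event (k |: J)%SET B2) = (N B' * P E)%E.
    rewrite /event hindep// finset.big_setU1//= {1}/B2 eqxx; congr (_ * _)%E.
      exact: hnormal.
    by rewrite /E /event hindep//; apply: eq_bigr => i iJ; rewrite B2J.
  have mJ2 i : i \in (k |: J)%SET -> (m <= i)%N.
    by rewrite finset.in_setU1 => /orP[/eqP ->//|/mJ/ltnW].
  have := law _ _ _ mJ2 mB2 mA'; rewrite PE2 E2 -/X setIA => lawE.
  refine (etrans lawE _).
  rewrite [RHS]muleC -muleA; congr (_ * _)%E.
  refine (etrans (esym (nuE (fun z => (\1_A' z)%:E) _ _)) (finite_integral_indic nu mA')).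
  - by apply/measurable_EFinP; exact: measurable_indic.
  - by move=> z; rewrite lee_fin indicE ler0n.
have joint := joint_law_product (Q := mrestr P mE) (m1 := nu) (m2 := N) mX
  (measurable_funP (eps k)) XZ mC.
transitivity (P ((fun w => (X w, eps k w)) @^-1` C `&` E)).
  congr (P (_ `&` _)); apply/seteqP; split => w;
    by rewrite /C /= /linear_form !(sum_ltnS _ k).
refine (etrans joint _).
rewrite (nuE (fun p => \int[N]_z (\1_C (p, z))%:E)%E); last 2 first.
- have mg : measurable_fun [set: R * R * R] (fun z => (\1_C z : R)%:E).
    by apply/measurable_EFinP; exact: measurable_indic.
  have g0 z : (0 <= (\1_C z : R)%:E)%E by rewrite lee_fin indicE ler0n.
  by have := measurable_fun_fubini_tonelli_F (m2 := N) _ mg g0.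
- by move=> z; apply: integral_ge0 => y _; rewrite lee_fin indicE ler0n.
refine (congr1 (mule (P E)) _).
refine (etrans _ (addE (fun z => (\1_A z)%:E) _ _)).
- by [].
- by apply/measurable_EFinP; exact: measurable_indic.
- by move=> z; rewrite lee_fin indicE ler0n.
Qed.
End gaussian_linear_forms.

(** * Sheppard's formula for two half-spaces *)

Section sheppard.
Context d (T : measurableType d) (R : realType) (P : probability T R).
Variables (sigma : R) (n : nat) (eps : 'I_n -> {RV P >-> R}).
Hypothesis sigma_gt0 : 0 < sigma.
Hypothesis hnormal : forall k, normally_distributed (eps k) 0 sigma.
Hypothesis hindep : mutually_independent eps.

Definition nonpos_form (a : 'I_n -> R) (w : T) : bool :=
  \sum_(i < n) a i * eps i w <= 0.

Lemma linear_form_full (a : 'I_n -> R) w :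
  linear_form eps n a w = \sum_(i < n) a i * eps i w.
Proof. by apply: eq_bigl => i; rewrite ltn_ord. Qed.

Lemma measurable_nonpos_form a : measurable_fun setT (nonpos_form a).
Proof.
rewrite (_ : nonpos_form a = fun w => linear_form eps n a w <= 0); last first.
  by apply/funext => w; rewrite linear_form_full.
by apply: measurable_fun_ler => //; exact: measurable_linear_form.
Qed.

(** All [n] variables are used and the event on later ones is the whole space. The Gram identities
    for [u], [v], [t] turn the planar ratio [v / sqrt (v ^+ 2 + t ^+ 2)] into the correlation. *)
Lemma sheppard (a b : 'I_n -> R) :
  0 < \sum_(i < n) a i ^+ 2 -> 0 < \sum_(i < n) b i ^+ 2 ->
  P [set w | nonpos_form a w && nonpos_form b w] =
  (4^-1 + asin ((\sum_(i < n) a i * b i) /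
     Num.sqrt ((\sum_(i < n) a i ^+ 2) * \sum_(i < n) b i ^+ 2)) / (2 * pi))%:E.
Proof.
move=> a2 b2.
have [u [v [t [u0 t0 [uE uvE vtE] law]]]] :=
  partial_linear_forms_law sigma_gt0 hnormal hindep a b (leqnn n).
have full (F : 'I_n -> R) : \sum_(i < n | (i < n)%N) F i = \sum_(i < n) F i.
  by apply: eq_bigl => i; rewrite ltn_ord.
rewrite !full in uE uvE vtE.
have {}u0 : 0 < u.
  by rewrite lt0r u0 andbT; apply: contraTneq a2 => u00; rewrite -uE u00 expr0n ltxx.
pose A : set (R * R) := [set z | (z.1 <= 0) && (z.2 <= 0)].
have := law finset.set0 (fun=> [set: R]) A.
rewrite (_ : [set` finset.set0] = set0); last first.
  by apply/seteqP; split => // i /=; rewrite finset.in_set0.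
rewrite /= bigcap_set0 setIT probability_setT mul1e => lawE.
have -> : [set w | nonpos_form a w && nonpos_form b w] =
    (fun w => (linear_form eps n a w, linear_form eps n b w)) @^-1` A.
  by apply/seteqP; split => w /=; rewrite /nonpos_form -!linear_form_full.
rewrite lawE//.
- under eq_integral do under eq_integral do rewrite indicE in_mkset/=.
  rewrite gaussian_quadrant// ?vtE// -uE -uvE; congr (_ + asin _ / _)%:E.
  rewrite sqrtrM ?sqr_ge0// sqrtr_sqr gtr0_norm//.
  by rewrite -mulf_div divff ?mul1r// gt_eqF.
- by move=> i; rewrite finset.in_set0.
- rewrite -[X in measurable X]setTI.
  have : measurable_fun [set: R * R] (fun z : R * R => (z.1 <= 0) && (z.2 <= 0)).
    by apply: measurable_and; exact: measurable_fun_ler.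
  by move=> /(_ measurableT [set true]); apply.
Qed.

End sheppard.

(** * Calculus of finite means *)

Section finite_mean.
Context d (T : measurableType d) (R : realType) (P : probability T R).

(** Integrability travels with the value, so that linearity applies to sums term by term. *)
Definition has_mean (X : T -> R) (r : R) : Prop :=
  P.-integrable setT (EFin \o X) /\ (\int[P]_w (X w)%:E = r%:E)%E.

Lemma has_mean_expectation X r : has_mean X r -> 'E_P[X]%E = r%:E.
Proof. by move=> [_ XE]; rewrite unlock. Qed.

Lemma has_meanD X Y r s : has_mean X r -> has_mean Y s ->
  has_mean (fun w => X w + Y w) (r + s).
Proof.
move=> [iX XE] [iY YE]; split.
  exact: (integrableD measurableT iX iY).
by refine (etrans (integralD_EFin measurableT iX iY) _); rewrite XE YE.
Qed.

Lemma has_meanB X Y r s : has_mean X r -> has_mean Y s ->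
  has_mean (fun w => X w - Y w) (r - s).
Proof.
move=> [iX XE] [iY YE]; split.
  exact: (integrableB measurableT iX iY).
by refine (etrans (integralB_EFin measurableT iX iY) _); rewrite XE YE.
Qed.

Lemma has_mean0 : has_mean (fun=> 0) 0.
Proof. by split; [exact: integrable0|rewrite integral0]. Qed.

Lemma has_mean_sum (I : finType) (X : I -> T -> R) (r : I -> R) :
  (forall i, has_mean (X i) (r i)) ->
  has_mean (fun w => \sum_i X i w) (\sum_i r i).
Proof.
move=> h; rewrite (_ : (fun w => _) = \sum_i X i); last first.
  by apply/funext => w; rewrite fct_sumE.
by elim/big_ind2 : _ => [|????|i _]; [exact: has_mean0|exact: has_meanD|exact: h].
Qed.

Lemma has_mean_natr (b : T -> bool) r : measurable_fun setT b ->
  P [set w | b w] = r%:E -> has_mean (fun w => (b w)%:R) r.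
Proof.
move=> mb Pb; have mB : measurable [set w | b w].
  by rewrite -[X in measurable X]setTI; exact: (mb measurableT [set true]).
have bE : (fun w => (b w)%:R) = \1_[set w | b w] :> (T -> R).
  by apply/funext => w; rewrite indicE in_mkset.
rewrite bE; split; first exact: integrable_indic.
by rewrite integral_indic// setIT.
Qed.

End finite_mean.

(** * Gram matrices of row differences, and the leverage condition *)

Section residual_maker.
Context {R : realType} (n p : nat) (D : 'M[R]_(n, p)).
Hypothesis hD : \rank D = p.
Local Notation H := (hat_matrix D).
Local Notation M := (1%:M - hat_matrix D).

Lemma sum_sqr_row (m : nat) (v : 'rV[R]_m) : (v *m v^T) 0 0 = \sum_i v 0 i ^+ 2.
Proof. by rewrite mxE; apply: eq_bigr => i _; rewrite mxE. Qed.

(** If [v] annihilates the matrix, then the squared norm of [v *m D^T] is zero, and the rows of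
    [D^T] are linearly independent. *)
Lemma normal_equations_unitmx : D^T *m D \in unitmx.
Proof.
rewrite -row_free_unit; apply/inj_row_free => v vDD.
have Dfree : row_free D^T by rewrite /row_free mxrank_tr hD.
apply/(row_free_inj Dfree); rewrite /= mul0mx.
have : \sum_i (v *m D^T) 0 i ^+ 2 = 0.
  by rewrite -sum_sqr_row trmx_mul trmxK mulmxA -(mulmxA v) vDD mul0mx mxE.
move/eqP; rewrite psumr_eq0 => [/allP v0|i _]; last exact: sqr_ge0.
apply/rowP => i; rewrite [RHS]mxE; apply/eqP.
by rewrite -sqrf_eq0; apply: v0; rewrite mem_index_enum.
Qed.

Lemma trmx_hat_matrix : H^T = H.
Proof.
by rewrite /hat_matrix !trmx_mul trmx_inv trmx_mul !trmxK mulmxA.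
Qed.

Lemma hat_matrix_idem : H *m H = H.
Proof.
rewrite /hat_matrix -!mulmxA (mulmxA D^T) (mulmxA (invmx _)).
by rewrite mulVmx ?mul1mx// normal_equations_unitmx.
Qed.

Lemma trmx_residual_maker : M^T = M.
Proof. by rewrite linearB/= trmx1 trmx_hat_matrix. Qed.

(** By symmetry and idempotence; inner products of rows of [M] are thus entries of [M]. *)
Lemma residual_maker_gram : M *m M^T = M.
Proof.
rewrite trmx_residual_maker mulmxBl mul1mx mulmxBr mulmx1 hat_matrix_idem.
by rewrite subrr subr0.
Qed.

Lemma residualsE (e : 'I_n -> R) k : residuals D e k = \sum_m M k m * e m.
Proof. by rewrite /residuals mxE; apply: eq_bigr => m _; rewrite [X in _ * X]mxE. Qed.

(** For fixed [k] and [i], these are the coefficients in the errors of a difference of two residuals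
    ([K = M]) or of two errors ([K = 1%:M]). *)
Definition row_diff (K : 'M[R]_n) (k i m : 'I_n) : R := K k m - K i m.

(** Bilinearity. With [K] and [K'] among [1%:M] and [M], the matrix [G] is [1%:M] or [M], which
    produces [Delta4] or [Delta4] minus [H4]. *)
Lemma sum_row_diff (K K' G : 'M[R]_n) (k i l j : 'I_n) : K *m K'^T = G ->
  \sum_m row_diff K k i m * row_diff K' l j m = G k l + G i j - G k j - G i l.
Proof.
have KE (x y : 'I_n) : (K *m K'^T) x y = \sum_m K x m * K' y m.
  by rewrite mxE; apply: eq_bigr => m _; rewrite mxE.
move=> <-; rewrite !KE -big_split/= -!sumrB; apply: eq_bigr => m _.
by rewrite /row_diff; ring.
Qed.

Lemma Delta4E (k l i j : 'I_n) :
  Delta4 R k l i j = 1%:M k l + 1%:M i j - 1%:M k j - 1%:M i l.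
Proof. by rewrite /Delta4 !mxE. Qed.

Lemma gram_eps (k i l j : 'I_n) :
  \sum_m row_diff 1%:M k i m * row_diff 1%:M l j m = Delta4 R k l i j.
Proof. by rewrite (@sum_row_diff _ _ 1%:M) ?trmx1 ?mulmx1// Delta4E. Qed.

Let Delta4_H4 (k l i j : 'I_n) :
  M k l + M i j - M k j - M i l = Delta4 R k l i j - H4 D k l i j.
Proof. by rewrite Delta4E /H4 !mxE; ring. Qed.

Lemma gram_res (k i l j : 'I_n) :
  \sum_m row_diff M k i m * row_diff M l j m = Delta4 R k l i j - H4 D k l i j.
Proof. by rewrite (sum_row_diff _ _ _ _ residual_maker_gram) Delta4_H4. Qed.

Lemma gram_res_eps (k i l j : 'I_n) :
  \sum_m row_diff M k i m * row_diff 1%:M l j m = Delta4 R k l i j - H4 D k l i j.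
Proof. by rewrite (@sum_row_diff _ _ M) ?trmx1 ?mulmx1// Delta4_H4. Qed.

Lemma gram_eps_res (k i l j : 'I_n) :
  \sum_m row_diff 1%:M k i m * row_diff M l j m = Delta4 R k l i j - H4 D k l i j.
Proof. by rewrite (@sum_row_diff _ _ M) ?mul1mx ?trmx_residual_maker// Delta4_H4. Qed.

Lemma Delta4_diag (k i : 'I_n) : k != i -> Delta4 R k k i i = 2.
Proof.
move=> ki; rewrite /Delta4 !eqxx (negbTE ki) eq_sym (negbTE ki) !subr0.
by [].
Qed.

Lemma norm2_eps (k i : 'I_n) : k != i -> \sum_m row_diff 1%:M k i m ^+ 2 = 2.
Proof. by move=> ki; rewrite -(Delta4_diag ki) -gram_eps. Qed.

Lemma norm2_res (k i : 'I_n) : k != i ->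
  \sum_m row_diff M k i m ^+ 2 = 2 - H4 D k k i i.
Proof. by move=> ki; rewrite -(Delta4_diag ki) -gram_res. Qed.

Hypothesis hlev : (#|[pred i : 'I_n | (1 / 2 <= H i i)%R]| <= 1)%N.

(* If rows k and i of M agree, then x := M k k = M i i = M k i satisfies
   x >= 2 x^2 by idempotence, so both leverages 1 - x are at least 1/2. *)
Lemma norm2_res_gt0 (k i : 'I_n) : k != i -> 0 < 2 - H4 D k k i i.
Proof.
move=> ki; rewrite -norm2_res// lt0r sumr_ge0 ?andbT => [|m _]; last exact: sqr_ge0.
apply/negP; rewrite psumr_eq0 => [/allP r0|m _]; last exact: sqr_ge0.
have rowE m : M k m = M i m.
  apply/eqP; rewrite -subr_eq0 -sqrf_eq0; apply: r0.
  by rewrite mem_index_enum.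
have symM (x y : 'I_n) : M x y = M y x by rewrite -[in LHS]trmx_residual_maker mxE.
have x_ik : M i k = M k k by rewrite rowE.
have x_ii : M i i = M k k by rewrite -rowE symM x_ik.
have sqrM (x : 'I_n) : M x x = \sum_m M x m ^+ 2.
  rewrite -[in LHS]residual_maker_gram mxE; apply: eq_bigr => m _.
  by rewrite [X in _ * X]mxE.
have le_half : M k k <= 1 / 2.
  (* Of the sum of squares of row [k], only the terms at [k] and [i] are kept. *)
  have x2 : 2 * M k k ^+ 2 <= M k k.
    rewrite {2}sqrM (bigD1 k)//= (bigD1 i) 1?eq_sym//= [M k i]symM x_ik.
    rewrite mulr_natl mulr2n lerD2l lerDl sumr_ge0// => m _; exact: sqr_ge0.
  have x0 : 0 <= M k k by rewrite sqrM sumr_ge0// => m _; exact: sqr_ge0.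
  nra.
have ME x : M x x = 1 - H x x.
  by rewrite mxE [1%:M _ _]mxE eqxx [(- H) _ _]mxE.
have hk : 1 / 2 <= H k k by move: le_half; rewrite ME; lra.
have hi : 1 / 2 <= H i i by move: le_half; rewrite -x_ii ME; lra.
move: hlev; rewrite leqNgt => /negP; apply.
have : [:: k; i] \subset [pred i : 'I_n | (1 / 2 <= H i i)%R].
  by apply/fintype.subsetP => x; rewrite !inE => /orP[] /eqP ->.
move=> /subset_leq_card; apply: leq_trans.
by have /card_uniqP -> : uniq [:: k; i] by rewrite /= inE ki.
Qed.

(** [H] is its own Gram matrix, so this is the squared norm of a difference of its rows. *)
Lemma H4_diag_ge0 (k i : 'I_n) : 0 <= H4 D k k i i.
Proof.
have HG : H *m H^T = H by rewrite trmx_hat_matrix hat_matrix_idem.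
rewrite /H4 -(sum_row_diff k i k i HG) sumr_ge0// => m _.
by rewrite -expr2 sqr_ge0.
Qed.

End residual_maker.

(** * Mean of a product of rank differences *)

Section rank_differences.
Context (R : realType) (n p : nat) (D : 'M[R]_(n, p)).
Hypothesis hD : \rank D = p.
Hypothesis hlev :
  (#|[pred i : 'I_n | (1 / 2 <= hat_matrix D i i)%R]| <= 1)%N.
Context (d : measure_display) (T : measurableType d) (P : probability T R).
Variables (sigma : R) (eps : 'I_n -> {RV P >-> R}).
Hypothesis sigma_gt0 : 0 < sigma.
Hypothesis hnormal : forall k, normally_distributed (eps k) 0 sigma.
Hypothesis hindep : mutually_independent eps.
Local Notation M := (1%:M - hat_matrix D).

(** This is [2 * pi] times the mean of [rank_diff_term k i] times [rank_diff_term l j]. *)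
Definition rank_summand (k l i j : 'I_n) : R :=
  asin (Delta4 R k l i j / 2)
  + asin ((Delta4 R k l i j - H4 D k l i j) /
          Num.sqrt ((2 - H4 D k k i i) * (2 - H4 D l l j j)))
  - asin ((Delta4 R k l i j - H4 D k l i j) / Num.sqrt (2 * (2 - H4 D k k i i)))
  - asin ((Delta4 R k l i j - H4 D k l i j) / Num.sqrt (2 * (2 - H4 D l l j j))).

Let rank_diff_term (k i : 'I_n) (w : T) : R :=
  (nonpos_form eps (row_diff M k i) w)%:R -
  (nonpos_form eps (row_diff 1%:M k i) w)%:R.

(** For [k = i] the row differences are zero and Sheppard's formula does not apply; the numerators
    vanish, in agreement with [rank_diff_term_diag]. *)
Lemma rank_summand_diagl (i l j : 'I_n) : rank_summand i l i j = 0.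
Proof.
rewrite /rank_summand (_ : Delta4 R i l i j = 0); last by rewrite /Delta4; ring.
rewrite (_ : H4 D i l i j = 0); last by rewrite /H4; ring.
by rewrite subrr !mul0r asin0 !subr0 addr0.
Qed.

Lemma rank_summand_diagr (k i j : 'I_n) : rank_summand k j i j = 0.
Proof.
rewrite /rank_summand (_ : Delta4 R k j i j = 0); last by rewrite /Delta4; ring.
rewrite (_ : H4 D k j i j = 0); last by rewrite /H4; ring.
by rewrite subrr !mul0r asin0 !subr0 addr0.
Qed.

Let rank_diff_term_diag (i : 'I_n) w : rank_diff_term i i w = 0.
Proof.
rewrite /rank_diff_term /nonpos_form !big1 ?subrr// => m _;
  by rewrite /row_diff subrr mul0r.
Qed.

Lemma nonpos_form_mean (K K' : 'M[R]_n) (k i l j : 'I_n) (g s s' : R) :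
  \sum_m row_diff K k i m * row_diff K' l j m = g ->
  \sum_m row_diff K k i m ^+ 2 = s -> \sum_m row_diff K' l j m ^+ 2 = s' ->
  0 < s -> 0 < s' ->
  has_mean P (fun w => (nonpos_form eps (row_diff K k i) w)%:R *
                       (nonpos_form eps (row_diff K' l j) w)%:R)
    (4^-1 + asin (g / Num.sqrt (s * s')) / (2 * pi)).
Proof.
move=> gE sE s'E s0 s'0; under eq_fun do rewrite -natrM mulnb.
apply: has_mean_natr.
  by apply: measurable_and; exact: measurable_nonpos_form.
by rewrite (sheppard sigma_gt0 hnormal hindep) ?sE ?s'E ?gE.
Qed.

Lemma rank_diff_term_mean (k l i j : 'I_n) :
  has_mean P (fun w => rank_diff_term k i w * rank_diff_term l j w)
    (1 / (2 * pi) * rank_summand k l i j).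
Proof.
have [->|ki] := eqVneq k i.
  rewrite rank_summand_diagl mulr0.
  under eq_fun do rewrite rank_diff_term_diag mul0r.
  exact: has_mean0.
have [->|lj] := eqVneq l j.
  rewrite rank_summand_diagr mulr0.
  under eq_fun do rewrite rank_diff_term_diag mulr0.
  exact: has_mean0.
(* There is one orthant probability for each pairing of residual ([r]) and error ([e]) half-spaces,
   the first letter referring to [(k, i)] and the second to [(l, j)]. *)
have rr := nonpos_form_mean (gram_res hD k i l j) (norm2_res hD ki)
  (norm2_res hD lj) (norm2_res_gt0 hD hlev ki) (norm2_res_gt0 hD hlev lj).
have ee := nonpos_form_mean (gram_eps k i l j) (norm2_eps ki) (norm2_eps lj)
  (ltr0Sn R 1) (ltr0Sn R 1).
have re := nonpos_form_mean (gram_res_eps D k i l j) (norm2_res hD ki)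
  (norm2_eps lj) (norm2_res_gt0 hD hlev ki) (ltr0Sn R 1).
have er := nonpos_form_mean (gram_eps_res D k i l j) (norm2_eps ki)
  (norm2_res hD lj) (ltr0Sn R 1) (norm2_res_gt0 hD hlev lj).
have := has_meanB (has_meanB (has_meanD ee rr) re) er.
congr (has_mean _ _ _).
  by apply/funext => w; rewrite /rank_diff_term; ring.
rewrite /rank_summand (_ : Num.sqrt (2 * 2) = 2 :> R); last first.
  by rewrite -expr2 sqrtr_sqr ger0_norm.
rewrite [(2 - H4 D k k i i) * 2]mulrC.
by ring.
Qed.

Lemma data_rank_diff (i : 'I_n) w :
  data_rank (residuals D (fun k => eps k w)) i - data_rank (fun k => eps k w) i =
  \sum_k rank_diff_term k i w.
Proof.
rewrite /data_rank -sumrB; apply: eq_bigr => k _; rewrite /rank_diff_term.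
congr (_%:R - _%:R).
  rewrite /nonpos_form !residualsE -subr_le0 -sumrB; congr (nat_of_bool (_ <= _)).
  by apply: eq_bigr => m _; rewrite mulrBl.
rewrite /nonpos_form -subr_le0; congr (nat_of_bool (_ <= _)).
have delta (x : 'I_n) : \sum_m (1%:M : 'M[R]_n) x m * eps m w = eps x w.
  rewrite (bigD1 x)//= mxE eqxx mul1r big1 ?addr0// => m mx.
  by rewrite mxE eq_sym (negbTE mx) mul0r.
by under eq_bigr do rewrite mulrBl; rewrite sumrB !delta.
Qed.

Lemma rank_diff_product_mean (i j : 'I_n) :
  has_mean P (fun w =>
    (data_rank (residuals D (fun k => eps k w)) i - data_rank (fun k => eps k w) i) *
    (data_rank (residuals D (fun k => eps k w)) j - data_rank (fun k => eps k w) j))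
  (1 / (2 * pi) * \sum_(k < n) \sum_(l < n) rank_summand k l i j).
Proof.
under eq_fun do rewrite !data_rank_diff mulr_suml.
under eq_fun do under eq_bigr do rewrite mulr_sumr.
rewrite mulr_sumr; under eq_bigr do rewrite mulr_sumr.
apply: has_mean_sum => k; apply: has_mean_sum => l.
exact: rank_diff_term_mean.
Qed.

End rank_differences.

(** * Trigonometric identities for the mean square *)

Section asin_acos.
Context {R : realType}.

(** The angles [pi / 3] and [pi / 6] are complementary, so [sin (2 x) = cos x] at [x = pi / 6];
    dividing by the cosine gives [2 sin x = 1]. *)
Lemma asin_half : asin (1 / 2) = pi / 6 :> R.
Proof.
have pi0 := pi_gt0 R.
have c0 : 0 < cos (pi / 6 : R) by apply: cos_gt0_pihalf; apply/andP; split; lra.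
have e : sin (pi / 6 *+ 2) = cos (pi / 6) :> R.
  rewrite -cosBpihalf -[RHS]cosN; congr cos.
  by rewrite mulr2n; move: (pi : R) => q; field.
have -> : 1 / 2 = sin (pi / 6) :> R.
  move: e; rewrite sin_mulr2n -mulrnAr => /(congr1 (fun z => (cos (pi / 6))^-1 * z)).
  by rewrite mulKf ?mulVf ?gt_eqF// mulr2n => e; lra.
by rewrite sinK// in_itv/=; apply/andP; split; lra.
Qed.

(** The root is [sin (acos y)], and [0 <= y] places [acos y] in [[0, pi / 2]], where [asin] inverts
    the sine. *)
Lemma asin_sqrt1B (y : R) : 0 <= y <= 1 -> asin (Num.sqrt (1 - y ^+ 2)) = acos y.
Proof.
move=> /andP[y0 y1]; have pi0 := pi_gt0 R.
have yI : -1 <= y <= 1 by rewrite y1 andbT (le_trans _ y0)// oppr_le0.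
have ay := acos_ge0 yI.
rewrite -sin_acos// sinK// in_itv/=; apply/andP; split; first by lra.
rewrite leNgt -ltr_cos ?in_itv/= ?ay ?acos_lepi//; last first.
  by apply/andP; split; lra.
by rewrite acosK ?in_itv//= cos_pihalf -leNgt.
Qed.

End asin_acos.

Lemma sum_sym_split (V : nmodType) (n : nat) (F : 'I_n -> 'I_n -> V) :
  (forall k l, F k l = F l k) ->
  \sum_k \sum_l F k l =
  \sum_k F k k + (\sum_(k < n) \sum_(l < n | (k < l)%N) F k l) *+ 2.
Proof.
move=> Fsym.
have lower : \sum_(k < n) \sum_(l < n | (l < k)%N) F k l =
    \sum_(k < n) \sum_(l < n | (k < l)%N) F k l.
  rewrite (exchange_big_dep xpredT)//=; apply: eq_bigr => k _.
  by apply: eq_bigr => l _; rewrite Fsym.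
rewrite mulr2n -{1}lower -!big_split/=; apply: eq_bigr => k _.
rewrite (bigD1 k)//= (bigID (fun l : 'I_n => (l < k)%N))/=; congr (_ + (_ + _)).
  by apply: eq_bigl => l; rewrite -val_eqE/=; case: ltngtP.
by apply: eq_bigl => l; rewrite -val_eqE/=; case: ltngtP.
Qed.

(** * Summands of the mean square *)

Section rank_summand_square.
Context (R : realType) (n p : nat) (D : 'M[R]_(n, p)).
Hypothesis hD : \rank D = p.
Hypothesis hlev :
  (#|[pred i : 'I_n | (1 / 2 <= hat_matrix D i i)%R]| <= 1)%N.

Lemma rank_summandC (k l i : 'I_n) : rank_summand D k l i i = rank_summand D l k i i.
Proof.
have symH (x y : 'I_n) : hat_matrix D x y = hat_matrix D y x.
  by rewrite -[in LHS](trmx_hat_matrix D) mxE.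
have DE : Delta4 R k l i i = Delta4 R l k i i.
  by rewrite /Delta4 (eq_sym k l) (eq_sym i l) (eq_sym k i) addrAC.
have HE : H4 D k l i i = H4 D l k i i.
  by rewrite /H4 (symH k l) (symH i l) (symH k i) addrAC.
rewrite /rank_summand DE HE [in Num.sqrt ((2 - H4 D k k i i) * _)]mulrC.
by rewrite [LHS]addrAC.
Qed.

(** For [k != i] the first two correlations are 1 and contribute [pi]; the other two are
    [sqrt (1 - h / 2)] with [h = H4 D k k i i], to which [asin_sqrt1B] applies. For [k = i] both
    sides are zero, as [acos 0 = pi / 2]. *)
Lemma rank_summand_diag (k i : 'I_n) :
  rank_summand D k k i i = pi - 2 * acos (Num.sqrt (H4 D k k i i / 2)).
Proof.
have [->|ki] := eqVneq k i.
  rewrite rank_summand_diagl (_ : H4 D i i i i = 0); last by rewrite /H4; ring.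
  by rewrite mul0r sqrtr0 acos0 mulrC divfK ?subrr.
rewrite /rank_summand Delta4_diag//.
have h0 := H4_diag_ge0 hD k i; have h2 := norm2_res_gt0 hD hlev ki.
move: (H4 D k k i i) h0 h2 => h h0 h2.
rewrite -expr2 sqrtr_sqr gtr0_norm// !divff ?gt_eqF// asin1.
have -> : (2 - h) / Num.sqrt (2 * (2 - h)) = Num.sqrt (1 - Num.sqrt (h / 2) ^+ 2).
  rewrite sqr_sqrtr ?divr_ge0//.
  have -> : 1 - h / 2 = (2 - h) ^+ 2 / (2 * (2 - h)) by field; rewrite gt_eqF.
  rewrite [RHS]sqrtrM ?sqr_ge0// sqrtr_sqr gtr0_norm// sqrtrV//.
  by rewrite mulr_ge0// ltW.
rewrite asin_sqrt1B.
  by rewrite -splitr; ring.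
rewrite sqrtr_ge0/= -[leRHS]sqrtr1 ler_wsqrtr//; lra.
Qed.

(** [Delta4] is 1 when [k], [l], [i] are distinct. If [k] or [l] equals [i] it is 0 instead, but
    then the arcsines on the right cancel in pairs and both sides are zero. *)
Lemma rank_summand_offdiag (k l i : 'I_n) : k != l ->
  rank_summand D k l i i =
  pi / 6
  + asin ((1 - H4 D k l i i) / Num.sqrt ((2 - H4 D k k i i) * (2 - H4 D l l i i)))
  - asin ((1 - H4 D k l i i) / Num.sqrt (2 * (2 - H4 D k k i i)))
  - asin ((1 - H4 D k l i i) / Num.sqrt (2 * (2 - H4 D l l i i))).
Proof.
move=> kl.
have s4 : Num.sqrt (2 * 2) = 2 :> R by rewrite -expr2 sqrtr_sqr ger0_norm.
have Hil x : H4 D i x i i = 0 by rewrite /H4; ring.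
have Hxi x : H4 D x i i i = 0 by rewrite /H4; ring.
have [kE|ki] := eqVneq k i.
  rewrite kE rank_summand_diagl !Hil !subr0 s4 asin_half; ring.
have [lE|li] := eqVneq l i.
  rewrite lE rank_summand_diagr !Hxi !subr0 s4 asin_half [_ * 2]mulrC; ring.
rewrite /rank_summand (_ : Delta4 R k l i i = 1) ?asin_half//.
by rewrite /Delta4 eqxx (negbTE kl) (negbTE ki) eq_sym (negbTE li) add0r !subr0.
Qed.

End rank_summand_square.

Local Close Scope classical_set_scope.
Theorem theorem1 (R : realType) (n p : nat) (hp : (1 <= p)%N) (hpn : (p < n)%N)
    (D : 'M[R]_(n, p)) (hD : \rank D = p)
    (d : measure_display) (T : measurableType d) (P : probability T R)
    (sigma : R) (hsigma : 0 < sigma)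
    (eps : 'I_n -> {RV P >-> R})
    (hnormal : forall k : 'I_n, normally_distributed (eps k) 0 sigma)
    (hindep : mutually_independent eps)
    (hlev : (#|[pred i : 'I_n | (1 / 2 <= hat_matrix D i i)%R]| <= 1)%N) :
  let rk (i : 'I_n) (w : T) : R := data_rank (fun k => eps k w) i in
  let rkhat (i : 'I_n) (w : T) : R :=
    data_rank (residuals D (fun k => eps k w)) i in
  let Delta := @Delta4 R n in
  let H := H4 D in
  (forall i j : 'I_n,
    'E_P[(fun w : T => (rkhat i w - rk i w) * (rkhat j w - rk j w))%R]%E =
    (1 / (2 * pi) *
     \sum_(k < n) \sum_(l < n)
       (asin (Delta k l i j / 2)
        + asin ((Delta k l i j - H k l i j) /
                Num.sqrt ((2 - H k k i i) * (2 - H l l j j)))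
        - asin ((Delta k l i j - H k l i j) / Num.sqrt (2 * (2 - H k k i i)))
        - asin ((Delta k l i j - H k l i j) / Num.sqrt (2 * (2 - H l l j j)))))%:E)
  /\
  (forall i : 'I_n,
    'E_P[(fun w : T => (rkhat i w - rk i w) ^+ 2)%R]%E =
    (1 / (2 * pi) *
     \sum_(k < n) (pi - 2 * acos (Num.sqrt (H k k i i / 2)))
     + 1 / pi *
       \sum_(k < n) \sum_(l < n | (k < l)%N)
         (pi / 6
          + asin ((1 - H k l i i) /
                  Num.sqrt ((2 - H k k i i) * (2 - H l l i i)))
          - asin ((1 - H k l i i) / Num.sqrt (2 * (2 - H k k i i)))
          - asin ((1 - H k l i i) / Num.sqrt (2 * (2 - H l l i i)))))%:E).

Proof.
move=> rk rkhat Delta H.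
have mean i j := has_mean_expectation
  (rank_diff_product_mean hD hlev hsigma hnormal hindep i j).
split=> [i j|i]; first exact: mean.
have -> : 'E_P[(fun w : T => (rkhat i w - rk i w) ^+ 2)%R]%E =
    (1 / (2 * pi) * \sum_(k < n) \sum_(l < n) rank_summand D k l i i)%:E.
  by under [X in 'E_P[X]%E]eq_fun do rewrite expr2; exact: mean.
congr EFin.
(* The doubled upper triangle accounts for the prefactor [1 / pi] in place of [1 / (2 * pi)]. *)
rewrite sum_sym_split => [|k l]; last exact: rank_summandC.
rewrite mulrDr; congr (_ + _).
  by congr (_ * _); apply: eq_bigr => k _; exact: rank_summand_diag.
transitivity (1 / pi * \sum_(k < n) \sum_(l < n | (k < l)%N) rank_summand D k l i i).
  rewrite mulrnAr -mulrnAl; congr (_ * _).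
  by move: (pi : R) (pi_gt0 R) => q q0; field; rewrite gt_eqF.
congr (_ * _); apply: eq_bigr => k _; apply: eq_bigr => l kl.
by apply: rank_summand_offdiag; rewrite -val_eqE/= ltn_eqF.
Qed.
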